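(* Let $n\ge 1$. A set $A$ of positive integers of cardinality $n$ is sumset-distinct modulo $N=2^n$ if and only if its elements can be ordered as $A=\{a_0,a_1,\ldots,a_{n-1}\}$ such that $v_2(a_j)=j$ for every $0\le j\le n-1$.
   Context: A finite set of integers is called sumset-distinct modulo $N$ if all of its subsets (including the empty set, whose sum is $0$) have pairwise distinct sums modulo $N$. For a prime $p$ and a nonzero integer $m$, the $p$-adic valuation $v_p(m)$ is the integer $k\ge 0$ such that $p^k$ divides $m$ but $p^{k+1}$ does not. *)

(* Defs.v *)
From mathcomp Require Export all_boot all_order all_algebra finmap.

Set Implicit Arguments.
Unset Strict Implicit.
Unset Printing Implicit Defensive.

Local Open Scope fset_scope.
Local Open Scope ring_scope.

(* [x = y %[mod N]] is the integer congruence of intdiv.v. *)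
Definition sumset_distinct_mod (N : int) (A : {fset int}) : Prop :=
  forall B C : {fset int}, B `<=` A -> C `<=` A ->
    (\sum_(b <- B) b = \sum_(c <- C) c %[mod N])%Z -> B = C.

(* The p-adic valuation of a nonzero integer, for p prime; [logn] makes it 0
   outside of this domain. *)
Definition padic_val (p : nat) (m : int) : nat := logn p `|m|%N.

(* Main.v *)
Require Import Defs.
From mathcomp Require Import all_boot all_order all_algebra finmap.
From mathcomp Require Import all_field.

(** If the elements have distinct valuations 0, ..., n - 1, the subset sums are
distinct for a triangular reason: in the difference of two subset sums, the
element of least valuation j on which the subsets differ contributes a term of
valuation exactly j < n, and all the other terms that survive are divisible by
2 ^ (j + 1), so 2 ^ n does not divide the difference
([triangular_combination_eq0]).

Conversely, let A be sumset-distinct modulo N = 2 ^ n with n elements. Its 2 ^ n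
subset sums are then a complete system of residues modulo N, so that for every
complex z with z ^ N = 1 and z <> 1,
  \prod_(x in A) (1 + z ^ x) = \sum_(S subset A) z ^ (sum of S)
                             = \sum_(r < N) z ^ r = 0
([prod_1Dexprz_eq0]). Hence z ^ x = -1 for some x in A. Taking for z a
primitive root of unity of order 2 ^ (k + 1) with k < n, this equation says that
2 ^ (k + 1) divides 2 x but not x, that is, x has valuation k
([padic_val_of_exprz_eqN1]). So all the n valuations k < n occur in A, and as A
has n elements each of them occurs exactly once. *)

Set Implicit Arguments.
Unset Strict Implicit.
Unset Printing Implicit Defensive.

Import Order.TTheory GRing.Theory Num.Theory.

Local Open Scope fset_scope.
Local Open Scope ring_scope.

Lemma pow_dvdz_padic_val (p k : nat) (m : int) : prime p -> m != 0 ->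
  (p%:Z ^+ k %| m)%Z = (k <= padic_val p m)%N.
Proof.
by move=> p_pr m0; rewrite dvdzE abszX pfactor_dvdn // absz_gt0.
Qed.

(** The term of index j of the sum is the only one that could fail to be divisible
by p ^ (j + 1) once the c i with i < j are known to vanish, whence an induction
on j. The coefficients met below are differences of indicators, and -1, 0, 1
satisfy the hypothesis that those divisible by p are 0. *)
Lemma triangular_combination_eq0 (p n : nat) (a c : 'I_n -> int) :
    prime p -> (forall j, a j != 0) -> (forall j, padic_val p (a j) = j) ->
    (forall j, (p %| c j)%Z -> c j = 0) ->
    (p%:Z ^+ n %| \sum_j c j * a j)%Z ->
  forall j, c j = 0.
Proof.
move=> p_pr a0 va c_small pn_dvd [j ltjn].
elim/ltn_ind: j ltjn => j IHj ltjn; set j' := Ordinal ltjn.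
have dvd_sum : (p%:Z ^+ j.+1 %| \sum_i c i * a i)%Z.
  by apply: dvdz_trans pn_dvd; apply: dvdz_exp2l.
apply/eqP/negPn/negP => cj0.
have dvd_rest : (p%:Z ^+ j.+1 %| \sum_(i | i != j') c i * a i)%Z.
  apply: rpred_sum => i neq_ij.
  have [lt_ij|lt_ji|eq_ij] := ltngtP i j.
  - by case: i lt_ij neq_ij => i ltin lt_ij _; rewrite IHj // mul0r rpred0.
  - by apply: dvdz_mull; rewrite pow_dvdz_padic_val // va.
  - by rewrite -(inj_eq val_inj) /= eq_ij eqxx in neq_ij.
move: dvd_sum; rewrite (bigD1 j') //= rpredDr //.
rewrite pow_dvdz_padic_val ?mulf_neq0 // /padic_val abszM.
rewrite lognM ?absz_gt0 // [logn p `|a j'|]va /= lognE p_pr absz_gt0 cj0 /=.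
case: ifP; last by rewrite add0n ltnn.
move=> pc; suff /c_small/eqP : (p %| c j')%Z by rewrite (negPf cj0).
by rewrite dvdzE.
Qed.

Lemma sum_fset_indicator (n : nat) (a : 'I_n -> int) (B : {fset int}) :
    injective a -> B `<=` [fset a j | j : 'I_n] ->
  \sum_(b <- B) b = \sum_j (a j \in B)%:R * a j.
Proof.
move=> inj_a sBA.
rewrite (eq_bigr (fun j => if a j \in B then a j else 0)); last first.
  by move=> j _; case: (a j \in B); rewrite ?mul1r ?mul0r.
transitivity (\sum_(b <- [fset a j | j : 'I_n]) if b \in B then b else 0).
  rewrite -(big_fset_incl _ sBA) => [|x _ /negPf-> //].
  by apply: eq_big_seq => b ->.
by rewrite big_imfset /= ?big_enum //; apply: in2W.
Qed.

(** Two subsets with congruent sums give a combination of the a j, divisible by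
p ^ n, whose coefficients are the differences of the two indicators. *)
Lemma sumset_distinct_of_padic_val (p n : nat) (a : 'I_n -> int) :
    prime p -> (forall j, a j != 0) -> (forall j, padic_val p (a j) = j) ->
  sumset_distinct_mod (p%:Z ^+ n) [fset a j | j : 'I_n].
Proof.
move=> p_pr a0 va B C sB sC /eqP; rewrite eqz_mod_dvd.
have inj_a : injective a by move=> i j eq_a; apply: val_inj; rewrite /= -!va eq_a.
rewrite !(sum_fset_indicator inj_a) // -sumrB.
under eq_bigr do rewrite -mulrBl.
move=> pn_dvd; pose c j : int := (a j \in B)%:R - (a j \in C)%:R.
have c_small j : (p %| c j)%Z -> c j = 0.
  have p1 : (p %| 1)%Z = false by rewrite dvdzE dvdn1 gtn_eqF ?prime_gt1.
  rewrite /c; case: (a j \in B); case: (a j \in C) => //=.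
    by rewrite subr0 p1.
  by rewrite sub0r rpredN p1.
have eqBC j : (a j \in B) = (a j \in C).
  have := triangular_combination_eq0 p_pr a0 va c_small pn_dvd j.
  by rewrite /c; case: (a j \in B); case: (a j \in C).
apply/fsetP => x; apply/idP/idP => x_in.
- have /imfsetP[j _ def_x] := fsubsetP sB x x_in.
  by rewrite def_x -eqBC -def_x.
- have /imfsetP[j _ def_x] := fsubsetP sC x x_in.
  by rewrite def_x eqBC -def_x.
Qed.

Lemma prod_1Dexprz (F : fieldType) (z : F) (A : {fset int}) : z != 0 ->
  \prod_(x <- A) (1 + z ^ x) =
  \sum_(S : {set A}) z ^ (\sum_(b <- [fsetval x in S]) b).
Proof.
move=> z0; rewrite big_seq_fsetE /=.
under eq_bigr do rewrite addrC.
rewrite bigA_distr; apply: eq_big => // S _.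
rewrite -big_mkcond /= big_imfset /=; last by apply: in2W; apply: val_inj.
rewrite (big_morph _ (fun x y => expfzDr x y z0) (expr0z z)) -[LHS]big_enum.
by apply/perm_big/uniq_perm; rewrite ?enum_uniq ?enum_finmem_uniq // => x;
  rewrite mem_enum enum_finmemE.
Qed.

(** Injectivity forces the 2 ^ #|A| subset sums to run over all residues modulo N,
so the expanded product is the full geometric sum of the powers of z. *)
Lemma prod_1Dexprz_eq0 (N : nat) (A : {fset int}) (F : fieldType)
    (z : F) :
    N = (2 ^ #|` A|)%N -> sumset_distinct_mod N A -> z ^+ N = 1 -> z != 1 ->
  \prod_(x <- A) (1 + z ^ x) = 0.
Proof.
move=> defN distA zN z1.
have N0 : N%:Z != 0 by rewrite defN eqz_nat expn_eq0.
have z0 : z != 0.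
  apply: contra_eq_neq zN => ->; rewrite expr0n defN expn_eq0 /=.
  by rewrite eq_sym oner_eq0.
pose s (S : {set A}) := (\sum_(b <- [fsetval x in S]) b)%R : int.
pose r S := `|(s S %% N)%Z|%N.
have rE S : (r S)%:Z = (s S %% N)%Z by rewrite abszE ger0_norm ?modz_ge0.
have zs S : z ^ s S = z ^+ r S.
  rewrite {1}(divz_eq (s S) N) expfzDr // -rE [X in z ^ X * _]mulrC.
  by rewrite -[z ^ (_ * _)]exprz_exp -!exprnP zN exp1rz mul1r.
have inj_r : injective r.
  move=> S T eq_r; rewrite -[S]FSetK -[T]FSetK; congr fsub.
  by apply: distA; rewrite ?fset_sub_val // -!rE eq_r.
have perm_r : perm_eq [seq r X | X : {set A}] (iota 0 N).
  have uniq_r : uniq [seq r X | X : {set A}].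
    by rewrite map_inj_uniq // enum_uniq.
  apply: uniq_perm; rewrite ?iota_uniq //.
  apply: (uniq_min_size uniq_r _ _).2.
    move=> _ /mapP[S _ ->]; rewrite mem_iota /= add0n -ltz_nat rE.
    by rewrite ltz_pmod // lt_def N0.
  by rewrite size_iota size_map -cardE -cardsT -powersetT card_powerset cardsT defN cardfE.
rewrite prod_1Dexprz // (eq_bigr _ (fun S _ => zs S)).
rewrite -big_enum -(big_map r xpredT (fun i => z ^+ i)) (perm_big _ perm_r) /=.
rewrite -{1}[N]subn0 -/(index_iota 0 N) big_mkord.
by apply: (mulfI (x := z - 1)); rewrite ?subr_eq0 // mulr0 -subrX1 zN subrr.
Qed.

(** From z ^ m = -1, which is not 1 but has square 1, the order 2 ^ (k + 1) of z
divides 2 m and does not divide m. *)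
Lemma padic_val_of_exprz_eqN1 (F : numFieldType) (z : F) (k : nat) (m : int) :
  (2 ^ k.+1).-primitive_root z -> z ^ m = -1 -> padic_val 2 m = k.
Proof.
move=> prim_z zm.
have {}zm : z ^+ `|m| = -1.
  case: m zm => m //=; rewrite /exprz /= => /(congr1 GRing.inv).
  by rewrite invrK invrN1.
have N1 : -1 != 1 :> F by rewrite -subr_eq0 -opprD oppr_eq0 (pnatr_eq0 _ 2).
have m0 : (0 < `|m|)%N.
  by rewrite lt0n; apply: contra_eq_neq zm => ->; rewrite expr0 eq_sym.
apply/eqP; rewrite eqn_leq; apply/andP; split.
  rewrite leqNgt -pfactor_dvdn // (prim_order_dvd prim_z) zm //.
have : (2 ^ k.+1 %| 2 * `|m|)%N.
  by rewrite (prim_order_dvd prim_z) mulnC exprM zm sqrrN expr1n.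
by rewrite expnS dvdn_pmul2l // pfactor_dvdn.
Qed.

Lemma sumset_distinct_padic_val (n k : nat) (A : {fset int}) :
    #|` A| = n -> sumset_distinct_mod (2 ^+ n) A -> (k < n)%N ->
  exists2 x, x \in A & padic_val 2 x = k.
Proof.
move=> cardA distA ltkn.
have [|z prim_z] := @C_prim_root_exists (2 ^ k.+1); first by rewrite expn_gt0.
have : \prod_(x <- A) (1 + z ^ x) = 0.
  apply: (prod_1Dexprz_eq0 (N := 2 ^ n)); rewrite ?cardA //.
  - by rewrite -[_%:Z]natz natrX.
  - by apply/eqP; rewrite -(prim_order_dvd prim_z) dvdn_exp2l.
  - apply/eqP => z1; move: (prim_order_dvd prim_z 1).
    by rewrite z1 expr1n eqxx dvdn1 -(expn0 2) eqn_exp2l.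
move/eqP; rewrite prodf_seq_eq0 => /hasP[x xA /=].
rewrite addrC addr_eq0 => /eqP zx; exists x => //.
exact: padic_val_of_exprz_eqN1 prim_z zx.
Qed.

Theorem theorem1p4 (n : nat) (hn : (1 <= n)%N) (A : {fset int})
    (Apos : forall x : int, x \in A -> 0 < x) (cardA : #|` A| = n) :
  sumset_distinct_mod (2 ^+ n) A <->
  exists a : 'I_n -> int,
    A = [fset a j | j : 'I_n] /\
    forall j : 'I_n, padic_val 2 (a j) = j :> nat.
Proof.
split=> [distA | [a [defA va]]]; last first.
  rewrite defA; apply: (@sumset_distinct_of_padic_val 2) => // j.
  by rewrite gt_eqF // Apos // defA; apply/imfsetP; exists j.
have /fin_all_exists2[a aA va] (j : 'I_n) :
    exists2 x, x \in A & padic_val 2 x = j.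
  exact: sumset_distinct_padic_val cardA distA (ltn_ord j).
(* The a j are n distinct elements of A, hence all of A. *)
exists a; split=> //; apply/eqP; rewrite eq_sym eqEfcard; apply/andP; split.
  by apply/fsubsetP => _ /imfsetP[j _ ->].
rewrite card_imfset /=; first by rewrite -cardE card_ord cardA.
by move=> i j eq_a; apply: val_inj; rewrite /= -!va eq_a.
Qed.
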